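(* Let $n\ge 1$ be an integer, let $f\in C^1(\mathbb{T},(0,\infty))$ and $g\in C^2(\mathbb{T},(0,\infty))$. For each $\varepsilon>0$ let $u^\varepsilon$ be the solution, with quenching time $T^\ast_\varepsilon\in(0,\infty]$, of $$u^\varepsilon_t=\frac{u^\varepsilon_{xx}}{(u^\varepsilon_x)^2+1}-\frac{n-1}{u^\varepsilon}+\frac1\varepsilon f(x)\sqrt{(u^\varepsilon_x)^2+1}\quad\text{for } x\in\mathbb{T},\ t\in(0,T^\ast_\varepsilon),\qquad u^\varepsilon(x,0)=\varepsilon\, g(x)\quad\text{for } x\in\mathbb{T}.$$ If $\max_{x\in\mathbb{T}}f(x)g(x)<n-1$, then an $\varepsilon$-limit quenching happens, that is, there exist a sequence $\{\varepsilon_k\}_{k\in\mathbb{N}}\subset(0,\infty)$ with $\varepsilon_k\to0$ as $k\to\infty$ and points $(x_k,t_k)\in\mathbb{T}\times(0,T^\ast_{\varepsilon_k})$ such that $$\frac{u^{\varepsilon_k}(x_k,t_k)}{\varepsilon_k}\to0\quad\text{as } k\to\infty.$$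
   Context: $\mathbb{T}=\mathbb{R}/\mathbb{Z}$ is the one-dimensional flat torus; functions on $\mathbb{T}$ are identified with $\mathbb{Z}$-periodic functions on $\mathbb{R}$. The solution $u^\varepsilon$ is the unique positive classical solution, which exists as long as its infimum over $\mathbb{T}$ stays positive. The quenching time is $T^\ast_\varepsilon:=\sup\{t>0\mid \inf_{x\in\mathbb{T}}u^\varepsilon(x,t)>0\}\in(0,\infty]$; if $T^\ast_\varepsilon<\infty$, the solution reaches the value $0$ at time $T^\ast_\varepsilon$, i.e. $\inf_{\mathbb{T}\times[0,T^\ast_\varepsilon)}u^\varepsilon=0$. *)

(* Defs.v *)
From HB Require Import structures.
From mathcomp Require Import all_boot all_order all_algebra.
From mathcomp Require Import all_classical all_reals all_analysis.
Set Implicit Arguments.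
Unset Strict Implicit.
Unset Printing Implicit Defensive.
Import Order.TTheory GRing.Theory Num.Theory.
Import numFieldNormedType.Exports.
Local Open Scope classical_set_scope.
Local Open Scope ring_scope.

(* Functions on the torus R/Z are 1-periodic functions on the line; a point of
   the torus is given by any of its representatives. *)
Definition torus_fun (R : realType) (f : R -> R) : Prop :=
  periodic f 1.

Definition class_C (R : realType) (k : nat) (f : R -> R) : Prop :=
  (forall j x, (j < k)%N -> derivable (derive1n j f) x 1) /\
  continuous (derive1n k f).

(* u x t is the value at the point x and the time t. *)
Definition dt (R : realType) (u : R -> R -> R) (x t : R) : R := derive1 (u x) t.
Definition dx (R : realType) (u : R -> R -> R) (x t : R) : R :=
  derive1 (u ^~ t) x.
Definition dxx (R : realType) (u : R -> R -> R) (x t : R) : R := dx (dx u) x t.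

(* A solution is represented by a total function of time. Only its values on
   [0, quenching_time u[ are constrained by quenching_solution below; a solution
   that ceases to exist at a finite time is extended, e.g. by 0, so that no
   later time contributes to the supremum. *)
Definition quenching_time (R : realType) (u : R -> R -> R) : \bar R :=
  ereal_sup [set t%:E | t in [set t : R | 0 < t /\ 0 < inf (range (u ^~ t))]].

Definition half_open_cylinder (R : realType) (T : \bar R) : set (R * R) :=
  [set p : R * R | 0 <= p.2 /\ (p.2%:E < T)%E].

Definition open_cylinder (R : realType) (T : \bar R) : set (R * R) :=
  [set p : R * R | 0 < p.2 /\ (p.2%:E < T)%E].

(* u is continuous up to the initial time, and u, u_x, u_xx, u_t exist and are
   continuous at positive times before T. *)
Record class_C21 (R : realType) (T : \bar R) (u : R -> R -> R) : Prop :=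
  ClassC21 {
  C21_continuous :
    {within half_open_cylinder T, continuous (fun p : R * R => u p.1 p.2)};
  C21_derivable_t : forall x t, open_cylinder T (x, t) -> derivable (u x) t 1;
  C21_derivable_x : forall x t, open_cylinder T (x, t) ->
    derivable (u ^~ t) x 1;
  C21_derivable_xx : forall x t, open_cylinder T (x, t) ->
    derivable (dx u ^~ t) x 1;
  C21_continuous_dt :
    {within open_cylinder T, continuous (fun p : R * R => dt u p.1 p.2)};
  C21_continuous_dx :
    {within open_cylinder T, continuous (fun p : R * R => dx u p.1 p.2)};
  C21_continuous_dxx :
    {within open_cylinder T, continuous (fun p : R * R => dxx u p.1 p.2)}
}.

(* The positive classical solution u of
     u_t = u_xx / (u_x^2 + 1) - (n - 1) / u + (1 / eps) f(x) sqrt(u_x^2 + 1),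
     u(x, 0) = eps g(x).
   The last clause says that u exists as long as its infimum stays positive:
   its lifespan can be finite only because u reaches the value 0. *)
Record quenching_solution (R : realType) (n : nat) (f g : R -> R) (eps : R)
    (u : R -> R -> R) : Prop := QuenchingSolution {
  qsol_time_gt0 : (0 < quenching_time u)%E;
  qsol_torus : forall t, 0 <= t -> (t%:E < quenching_time u)%E ->
    torus_fun (u ^~ t);
  qsol_C21 : class_C21 (quenching_time u) u;
  qsol_gt0 : forall x t, half_open_cylinder (quenching_time u) (x, t) ->
    0 < u x t;
  qsol_eq : forall x t, open_cylinder (quenching_time u) (x, t) ->
    dt u x t = dxx u x t / (dx u x t ^+ 2 + 1) - (n%:R - 1) / u x t
               + eps^-1 * f x * Num.sqrt (dx u x t ^+ 2 + 1);
  qsol_init : forall x, u x 0 = eps * g x;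
  qsol_quench : (quenching_time u < +oo)%E ->
    inf [set u p.1 p.2 | p in half_open_cylinder (quenching_time u)] = 0
}.

Definition eps_limit_quenching (R : realType) (u : R -> R -> R -> R) : Prop :=
  exists (eps x t : nat -> R),
    [/\ forall k, 0 < eps k,
        eps @ \oo --> (0 : R),
        forall k, 0 < t k /\ ((t k)%:E < quenching_time (u (eps k)))%E
      & (fun k => u (eps k) (x k) (t k) / eps k) @ \oo --> (0 : R)].

(* Main.v *)
Require Import Defs.
From mathcomp Require Import all_boot all_order all_algebra.
From mathcomp Require Import all_classical all_reals all_analysis.
From mathcomp Require Import ring lra.
Import Order.TTheory GRing.Theory Num.Theory.
Import numFieldNormedType.Exports.
Local Open Scope classical_set_scope.
Local Open Scope ring_scope.

(* Under u = eps v, t = eps^2 tau the equation becomes, formally as eps -> 0, the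
   ODE v_tau = f - (n - 1) / v at each point x, whose right-hand side is at most
   -2c < 0 as long as v <= g, since f g <= n - 1 - 2 c g. Hence, once eps^2 is
   small enough for the terms in g' and g'' to be absorbed by half of this gap,
   w(x, t) = eps g(x) - c t / eps is a supersolution as long as it is positive,
   and u <= w. At a minimum point of g, the quotient w / eps becomes arbitrarily
   small in finite time; and if u ceases to exist before that time, it does so
   by reaching 0. *)

(** * Periodic functions *)

Lemma torus_fun_floor (R : realType) (f : R -> R) (x : R) :
  torus_fun f -> f (x - (Num.floor x)%:~R) = f x.
Proof.
move=> fT; have fn n y : f (y + n%:R) = f y.
  by rewrite (periodicn fT).
case: (Num.floor x) => m.
- by have := fn m (x - m%:R); rewrite subrK.
- by rewrite NegzE mulrNz opprK; exact: fn.
Qed.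

Lemma subr_floor_itv (R : realType) (x : R) :
  x - (Num.floor x)%:~R \in `[0, 1]%R.
Proof.
rewrite in_itv/= subr_ge0 ge_floor/= lerBlDl.
by have := floorD1_gt x; rewrite intrD => /ltW.
Qed.

Lemma torus_fun_max (R : realType) (f : R -> R) :
  torus_fun f -> continuous f -> exists c, forall x, f x <= f c.
Proof.
move=> fT fc.
have [c _ cM] := EVT_max ler01 (continuous_subspaceT fc).
exists c => x; rewrite -(torus_fun_floor _ _ x fT).
by apply: cM; exact: subr_floor_itv.
Qed.

Lemma torus_fun_derive1 (R : realType) (f : R -> R) :
  torus_fun f -> torus_fun (derive1 f).
Proof.
move=> fT x; rewrite /derive1.
suff -> : (fun h => h^-1 *: (f (h + (x + 1)) - f (x + 1))) =
          (fun h => h^-1 *: (f (h + x) - f x)) by [].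
by apply/funext => h; rewrite addrA !fT.
Qed.

Lemma torus_fun_bounded (R : realType) (f : R -> R) :
  torus_fun f -> continuous f -> exists M, forall x, `|f x| <= M.
Proof.
move=> fT fc.
have [c cM] : exists c, forall x, `|f x| <= `|f c|.
  apply: (torus_fun_max _ (fun x => `|f x|)) => x; first by rewrite fT.
  by apply: continuous_comp; [exact: fc|exact: norm_continuous].
by exists `|f c|.
Qed.

(** * Derivatives at maxima and the maximum principle *)

Lemma derive1_gt0_near (R : realType) (h : R -> R) (a : R) :
  derivable h a 1 -> 0 < derive1 h a ->
  \forall e \near 0^', 0 < e^-1 * (h (e + a) - h a).
Proof.
move=> dh; rewrite derive1E => h0.
have : (fun e => e^-1 *: (h (e *: 1 + a) - h a)) @ 0^' --> 'D_1 h a.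
  exact: dh.
move=> /cvgr_gt/(_ _ h0); apply: filterS => e.
by rewrite /GRing.scale/= mulr1.
Qed.

(** With a negative derivative, [h] would exceed [h a] just to the left of [a]. Only earlier points
    are compared, since [a] will be a time that may be the last one. *)
Lemma derive1_ge0_left_max (R : realType) (h : R -> R) (a : R) :
  0 < a -> derivable h a 1 -> (forall s, 0 <= s <= a -> h s <= h a) ->
  0 <= derive1 h a.
Proof.
move=> a0 dh hmax; rewrite leNgt; apply/negP => d0.
have dNh : derivable (- h) a 1 by exact: derivableN.
have d0' : 0 < derive1 (- h) a by rewrite derive1E deriveN// -derive1E oppr_gt0.
have /nbhs_ballP[r/= r0 rP] := derive1_gt0_near _ _ _ dNh d0'.
pose e := Num.min (r / 2) a.
have e0 : 0 < e by rewrite lt_min a0 divr_gt0.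
have er : e < r by rewrite gt_min ltr_pdivrMr// ltr_pMr// ltr1n.
have ea : e <= a by rewrite ge_min lexx orbT.
have := rP (- e); rewrite /ball/= sub0r opprK gtr0_norm// oppr_eq0 gt_eqF//.
move=> /(_ er isT).
rewrite invrN mulNr oppr_gt0 pmulr_rlt0 ?invr_gt0// opprK addrC.
have := hmax (- e + a); rewrite addrC !fctE; lra.
Qed.

(** If the second derivative were positive, [derive1 h], which vanishes at [a], would be positive
    just to the right of [a], and the mean value theorem would make [h] larger there. *)
Lemma derive11_le0_max (R : realType) (h : R -> R) (a : R) :
  (forall x, derivable h x 1) -> derivable (derive1 h) a 1 ->
  (forall x, h x <= h a) ->
  derive1 h a = 0 /\ derive1 (derive1 h) a <= 0.
Proof.
move=> dh ddh hmax.
have h'0 : derive1 h a = 0.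
  have [||||_ <-] := @derive1_at_max R h (a - 1) (a + 1) a.
  - lra.
  - by move=> *; exact: dh.
  - rewrite in_itv/=; lra.
  - by move=> *; exact: hmax.
  - by rewrite derive1E.
split => //; rewrite leNgt; apply/negP => d0.
have /nbhs_ballP[r/= r0 rP] := derive1_gt0_near _ _ _ ddh d0.
suff : h a < h (a + r / 2) by rewrite ltNge hmax.
have ar : a < a + r / 2 by rewrite ltrDl divr_gt0.
have ch x : {for x, continuous h}.
  by apply/differentiable_continuous/derivable1_diffP.
have [||c] := @MVT R h (derive1 h) a (a + r / 2) ar.
- by move=> x _; rewrite derive1E; exact: derivableP.
- by apply: continuous_subspaceT.
rewrite in_itv/= => /andP[ac cr] E.
rewrite -subr_gt0 E mulr_gt0 ?subr_gt0//.
have := rP (c - a); rewrite /ball/= sub0r subrK h'0 subr0 normrN.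
rewrite gtr0_norm ?subr_gt0//.
have -> : c - a < r by lra.
rewrite subr_eq0 gt_eqF// => /(_ isT isT).
by rewrite pmulr_rgt0 ?invr_gt0 ?subr_gt0.
Qed.

(** A positive value of [z] makes the maximum of [expR (- K * t) * z x t] positive. It is attained
    at a positive time, where the time derivative of this product is both nonnegative and, by the
    differential inequality, negative. *)
Lemma weak_maximum_principle (R : realType) (z : R -> R -> R) (T K : R) :
  0 <= T ->
  {within [set p : R * R | 0 <= p.2 <= T], continuous (fun p => z p.1 p.2)} ->
  (forall t, 0 <= t <= T -> torus_fun (z ^~ t)) ->
  (forall x t, 0 < t <= T -> derivable (z x) t 1) ->
  (forall x, z x 0 <= 0) ->
  (forall x t, 0 < t <= T -> 0 < z x t -> (forall y, z y t <= z x t) ->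
    dt z x t < K * z x t) ->
  forall x t, 0 <= t <= T -> z x t <= 0.
Proof.
move=> T0 zc zT zd z0 zlt y s sT; rewrite leNgt; apply/negP => zys.
pose F (p : R * R) := expR (- K * p.2) * z p.1 p.2.
pose A : set (R * R) := `[0, 1] `*` `[0, T].
have [|||p pA pmax] := @compact_EVT_max _ R F A.
- by exists (0, 0); split; rewrite /= in_itv/= lexx ?ler01.
- by apply: compact_setX; exact: segment_compact.
- apply: (@continuous_subspaceW _ _ _ [set p : R * R | 0 <= p.2 <= T]).
    by move=> [a b] [_] /=; rewrite in_itv.
  have ec : continuous (fun p : R * R => expR (- K * p.2)).
    move=> q; apply: continuous_comp; last exact: continuous_expR.
    by apply: cvgM; [exact: cvg_cst|exact: cvg_snd].
  by move=> q; apply: cvgM; [exact: (continuous_subspaceT ec)|exact: zc].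
(* Periodicity turns the maximum over one period into a maximum over the whole line. *)
have Fle x t : 0 <= t <= T -> F (x, t) <= F p.
  move=> tT; rewrite /F/= -(torus_fun_floor _ _ x (zT _ tT)).
  apply: (pmax (_, t)); rewrite inE; split => /=; last by rewrite in_itv.
  exact: subr_floor_itv.
case: p => x t in pA pmax Fle *; move: pA; rewrite inE => -[_] /=.
rewrite in_itv/= => tT.
have zxt : 0 < z x t.
  have := Fle y s sT; rewrite /F/= => H.
  rewrite -(pmulr_rgt0 _ (expR_gt0 (- K * t))); apply: lt_le_trans H.
  by rewrite mulr_gt0// expR_gt0.
have t0 : 0 < t.
  rewrite lt_neqAle (andP tT).1 andbT; apply/eqP => E.
  by move: zxt; rewrite -E ltNge z0.
have t0T : 0 < t <= T by rewrite t0 (andP tT).2.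
have zmax y' : z y' t <= z x t.
  by have := Fle y' t tT; rewrite /F/= ler_pM2l// expR_gt0.
have H := zlt x t t0T zxt zmax.
have zxd := zd x t t0T.
pose h r : R := expR (- K * r) * z x r.
have hd : is_derive t 1 h (expR (- K * t) * (dt z x t - K * z x t)).
  have [e1 e1E] : is_derive t (1 : R) (fun r => expR (- K * r))
      (- K * expR (- K * t)).
    have : is_derive t (1 : R) (fun r => - K * r) (- K).
      by apply: is_derive_eq; rewrite /GRing.scale/= ?mulr1.
    by move=> ?; apply: is_derive_eq; rewrite /GRing.scale/= mulrC.
  apply: DeriveDef; first exact: derivableM.
  rewrite deriveM// e1E /dt derive1E /GRing.scale/=; ring.
have : 0 <= derive1 h t.
  apply: derive1_ge0_left_max => // r /andP[r0 rt].
  apply: (Fle x r); rewrite r0/=; exact: le_trans rt (andP tT).2.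
rewrite derive1E; have [_ ->] := hd.
by rewrite pmulr_rge0 ?expR_gt0// subr_ge0 leNgt H.
Qed.

(** * The barrier *)

(** The pointwise estimate at a spatial maximum of u - w: [U] and [W] are the values of u and w, [A]
    is u_xx, [eps * p] the common slope, and the left-hand side is the time derivative of u - w. *)
Lemma barrier_speed (R : rcfType) (N c d eps f F g p M1 q M2 A U W : R) :
  0 < N -> 0 < eps -> 0 < d -> 0 < f <= F -> 0 < g ->
  f * g <= N - 2 * c * g -> `|p| <= M1 -> `|q| <= M2 ->
  eps ^+ 2 * (M2 + F * M1 ^+ 2) <= c ->
  A <= eps * q -> d * eps <= W <= eps * g -> W < U ->
  A / ((eps * p) ^+ 2 + 1) - N / U
    + eps^-1 * f * Num.sqrt ((eps * p) ^+ 2 + 1) + c / eps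
    < N / (d * eps) ^+ 2 * (U - W).
Proof.
move=> N0 e0 d0 /andP[f0 fF] g0 fg pM qM small Aq /andP[dW Wg] WU.
have de0 : 0 < d * eps by rewrite mulr_gt0.
have W0 : 0 < W by exact: lt_le_trans dW.
have U0 : 0 < U by exact: lt_trans WU.
have M20 : 0 <= M2 by exact: le_trans qM.
have s0 : 0 <= (eps * p) ^+ 2 by exact: sqr_ge0.
have s10 : 0 < (eps * p) ^+ 2 + 1 by lra.
have pM2 : p ^+ 2 <= M1 ^+ 2.
  rewrite -(@ger0_norm _ (p ^+ 2)) ?sqr_ge0// normrX.
  by rewrite lerXn2r// nnegrE// (le_trans _ pM).
have diff_le : A / ((eps * p) ^+ 2 + 1) <= eps * M2.
  rewrite ler_pdivrMr//; apply: (le_trans Aq).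
  have : q <= M2 by exact: le_trans (ler_norm _) qM.
  rewrite -(ler_pM2l e0) => /le_trans; apply.
  by rewrite ler_peMr ?mulr_ge0 ?(ltW e0)//; lra.
(* A number at least 1 dominates its root; the excess is quadratic in [eps], hence still of order
   [eps] after division by [eps]. *)
have sqrt_le : Num.sqrt ((eps * p) ^+ 2 + 1) <= (eps * p) ^+ 2 + 1.
  rewrite -[leRHS](@ger0_norm _ _ (ltW s10)) -sqrtr_sqr ler_wsqrtr//.
  by rewrite expr2 ler_peMr ?(ltW s10)//; lra.
have force_le : eps^-1 * f * Num.sqrt ((eps * p) ^+ 2 + 1) <=
    eps^-1 * f + eps * (F * M1 ^+ 2).
  have ef0 : 0 < eps^-1 * f by rewrite mulr_gt0 ?invr_gt0.
  apply: (le_trans (ler_wpM2l (ltW ef0) sqrt_le)).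
  have -> : eps^-1 * f * ((eps * p) ^+ 2 + 1) = eps^-1 * f + eps * (f * p ^+ 2).
    by field; exact: lt0r_neq0.
  rewrite lerD2l ler_pM2l//.
  by apply: ler_pM => //; [exact: ltW|exact: sqr_ge0].
have sing_le : eps^-1 * f - N / W <= - (2 * c) / eps.
  have : N / (eps * g) <= N / W.
    by rewrite ler_pM2l// lef_pV2// posrE// mulr_gt0.
  have -> : N / (eps * g) = eps^-1 * (N / g) by field; rewrite !lt0r_neq0.
  have : f <= N / g - 2 * c by rewrite -(ler_pM2r g0) mulrBl divfK ?lt0r_neq0.
  rewrite -(@ler_pM2l _ eps^-1) ?invr_gt0// mulrBr [_ / eps]mulrC mulrN.
  lra.
(* Both [U] and [W] are at least [d * eps], where the singular term is Lipschitz. *)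
have gap : N / W - N / U < N / (d * eps) ^+ 2 * (U - W).
  have -> : N / W - N / U = N * (U - W) * (U * W)^-1.
    by field; rewrite !lt0r_neq0.
  rewrite [ltRHS]mulrAC ltr_pM2l ?mulr_gt0 ?subr_gt0//.
  rewrite ltf_pV2 ?posrE ?mulr_gt0 ?exprn_gt0//.
  rewrite expr2 (@lt_le_trans _ _ (U * (d * eps)))// ?ler_pM2l// ltr_pM2r//.
  exact: le_lt_trans WU.
have slack : eps * M2 + eps * (F * M1 ^+ 2) <= c / eps.
  rewrite ler_pdivlMr//; apply: le_trans small.
  suff -> : (eps * M2 + eps * (F * M1 ^+ 2)) * eps =
      eps ^+ 2 * (M2 + F * M1 ^+ 2) by [].
  by ring.
(* One half of the gap pays for [slack], the other for the speed [c / eps] of the barrier. *)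
have E : - (2 * c) / eps = - (c / eps) - c / eps by field; exact: lt0r_neq0.
rewrite E in sing_le; lra.
Qed.

(** At a positive spatial maximum of u - w one has u_x = eps g' and u_xx <= eps g'', so the equation
    and [barrier_speed] give the inequality required by the maximum principle. The hypothesis
    involving [d] keeps w at least [d * eps] up to time [T]. *)
Lemma quenching_solution_barrier (R : realType) (n : nat) (f g : R -> R)
    (eps : R) (u : R -> R -> R) (c d F M1 M2 T : R) :
  quenching_solution n f g eps u -> torus_fun g -> class_C 2 g ->
  (1 < n%:R :> R) -> 0 < eps -> 0 < c -> 0 < d -> 0 <= T ->
  (T%:E < quenching_time u)%E ->
  (forall x, 0 < f x <= F) -> (forall x, 0 < g x) ->
  (forall x, f x * g x <= (n%:R - 1) - 2 * c * g x) ->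
  (forall x, `|derive1 g x| <= M1) ->
  (forall x, `|derive1 (derive1 g) x| <= M2) ->
  eps ^+ 2 * (M2 + F * M1 ^+ 2) <= c ->
  (forall x, d * eps <= eps * g x - c * T / eps) ->
  forall x t, 0 <= t <= T -> u x t <= eps * g x - c * t / eps.
Proof.
move=> hu gT [gd gc] n1 e0 c0 d0 T0 Tq fF g0 fg gM1 gM2 small dW x t tT.
have {hu} [_ uT [uc ut ux uxx _ _ _] _ ueq u0 _] := hu.
have dg y : derivable g y 1 by exact: (gd 0%N).
have ddg y : derivable (derive1 g) y 1 by exact: (gd 1%N).
have cg : continuous g.
  by move=> y; apply/differentiable_continuous/derivable1_diffP.
have ltq s : s <= T -> (s%:E < quenching_time u)%E.
  by move=> sT; apply: le_lt_trans Tq; rewrite lee_fin.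
pose z y s := u y s - (eps * g y - c * s / eps).
(* -(n - 1) / u increases with u, but where u > w >= d eps its growth is
   absorbed by the exponential factor K. *)
rewrite -subr_le0.
apply: (@weak_maximum_principle R z T ((n%:R - 1) / (d * eps) ^+ 2)) => //.
- have wc : continuous (fun p : R * R => eps * g p.1 - c * p.2 / eps).
    move=> p; apply: cvgB.
      apply: cvgM; first exact: cvg_cst.
      by apply: (@continuous_comp _ _ _ fst g); [exact: cvg_fst|exact: cg].
    apply: cvgM; last exact: cvg_cst.
    by apply: cvgM; [exact: cvg_cst|exact: cvg_snd].
  move=> p; apply: cvgB; last exact: (continuous_subspaceT wc).
  apply: (continuous_subspaceW _ uc) => -[a b] /= /andP[b0 bT].
  by split => //=; exact: ltq.
- move=> s /andP[s0 sT] y; rewrite /z gT.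
  by rewrite (uT s s0 (ltq s sT) y).
- move=> y s /andP[s0 sT]; apply: derivableB.
    by apply: ut; split => //=; exact: ltq.
  by apply: derivableB => //; apply: derivableM => //; apply: derivableM.
- by move=> y; rewrite /z u0 mulr0 mul0r subr0 subrr.
- move=> y s /andP[s0 sT] zpos zmax.
  have op y' : open_cylinder (quenching_time u) (y', s).
    by split => //=; exact: ltq.
  have dwx (y' : R) : is_derive y' (1 : R)
      (fun r : R => eps * g r - c * s / eps) (eps * derive1 g y').
    have gy' : is_derive y' (1 : R) g (derive1 g y').
      by rewrite derive1E; exact: derivableP.
    by apply: is_derive_eq; rewrite /GRing.scale/= subr0.
  have dzx (y' : R) : is_derive y' (1 : R) (z ^~ s)
      (dx u y' s - eps * derive1 g y').
    have uy' : is_derive y' (1 : R) (u ^~ s) (dx u y' s).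
      by rewrite /dx derive1E; apply: derivableP; exact: ux.
    exact: is_deriveB.
  have zxE : derive1 (z ^~ s) = (fun r : R => dx u r s - eps * derive1 g r).
    by apply/funext => r; rewrite derive1E; have [_ ->] := dzx r.
  have dzxx : is_derive y (1 : R) (derive1 (z ^~ s))
      (dxx u y s - eps * derive1 (derive1 g) y).
    have gy : is_derive y (1 : R) (derive1 g) (derive1 (derive1 g) y).
      by rewrite [X in is_derive _ _ _ X]derive1E; exact: derivableP.
    have uy : is_derive y (1 : R) (dx u ^~ s) (dxx u y s).
      by rewrite /dxx {2}/dx derive1E; apply: derivableP; exact: uxx.
    rewrite zxE; apply: is_deriveB.
  have zxxE : derive1 (derive1 (z ^~ s)) y =
      dxx u y s - eps * derive1 (derive1 g) y.
    by rewrite derive1E; have [_ ->] := dzxx.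
  have dzt : is_derive s (1 : R) (z y) (dt u y s + c / eps).
    have uy : is_derive s (1 : R) (u y) (dt u y s).
      by rewrite /dt derive1E; apply: derivableP; exact: ut.
    have wy : is_derive s (1 : R) (fun r : R => eps * g y - c * r / eps)
        (- (c / eps)).
      have -> : (fun r : R => eps * g y - c * r / eps) =
          (fun r : R => eps * g y - c / eps * r).
        by apply/funext => r; rewrite mulrAC.
      by apply: is_derive_eq; rewrite /GRing.scale/= mulr1 add0r mul1r.
    by rewrite -[c / eps]opprK; exact: is_deriveB.
  have ztE : dt z y s = dt u y s + c / eps.
    by rewrite {1}/dt derive1E; have [_ ->] := dzt.
  have [||ux0 uxx0] := derive11_le0_max _ (z ^~ s) y _ _ zmax.
  + by move=> r; have [] := dzx r.
  + by have [] := dzxx.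
  have uxE : dx u y s = eps * derive1 g y.
    by apply/eqP; rewrite -subr_eq0 -ux0 zxE.
  rewrite ztE ueq// uxE.
  apply: (barrier_speed _ (n%:R - 1) c d eps (f y) F (g y)
    (derive1 g y) M1 (derive1 (derive1 g) y) M2) => //.
  + by rewrite subr_gt0.
  + by rewrite -subr_le0 -zxxE.
  + apply/andP; split.
      apply: (le_trans (dW y)); rewrite lerD2l lerN2 ler_pM2r ?invr_gt0//.
      by rewrite ler_pM2l.
    by rewrite gerBl divr_ge0 ?mulr_ge0 ?ltW.
  + by rewrite -subr_gt0.
Qed.

(** * Small values and limit quenching *)

Lemma quenching_solution_small (R : realType) (n : nat) (f g : R -> R)
    (eps : R) (u : R -> R -> R) (c d F M1 M2 x0 : R) :
  quenching_solution n f g eps u -> torus_fun g -> class_C 2 g ->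
  (1 < n%:R :> R) -> 0 < eps -> 0 < c -> 0 < d ->
  (forall x, 0 < f x <= F) -> (forall x, 0 < g x) ->
  (forall x, f x * g x <= (n%:R - 1) - 2 * c * g x) ->
  (forall x, `|derive1 g x| <= M1) ->
  (forall x, `|derive1 (derive1 g) x| <= M2) ->
  eps ^+ 2 * (M2 + F * M1 ^+ 2) <= c ->
  (forall x, g x0 <= g x) -> d < g x0 ->
  exists x t, [/\ 0 < t, (t%:E < quenching_time u)%E & u x t <= d * eps].
Proof.
move=> hu gT gC n1 e0 c0 d0 fF g0 fg gM1 gM2 small gx0 dg.
(* The time at which the barrier over the minimum point [x0] has come down to [d * eps]. *)
pose T := eps ^+ 2 * (g x0 - d) / c.
have T0 : 0 < T by rewrite divr_gt0 ?mulr_gt0 ?exprn_gt0 ?subr_gt0.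
have TE : c * T / eps = eps * (g x0 - d).
  by rewrite /T; field; rewrite !lt0r_neq0.
have [Tq|qT] := ltP T%:E (quenching_time u).
  exists x0, T; split => //.
  have := quenching_solution_barrier _ _ _ _ _ _ c d F M1 M2 T hu gT gC n1 e0
    c0 d0 (ltW T0) Tq fF g0 fg gM1 gM2 small _ x0 T.
  rewrite TE lexx (ltW T0).
  have -> : eps * g x0 - eps * (g x0 - d) = d * eps by ring.
  apply => // x.
  have : eps * g x0 <= eps * g x by rewrite ler_pM2l.
  lra.
(* Here the lifespan is finite, so the infimum of u is 0 and some value lies below [d * eps]. *)
have := qsol_quench hu (le_lt_trans qT (ltry T)).
set S := [set _ | _ in _] => infS.
have S0 : S !=set0.
  by exists (u 0 0), (0, 0) => //; split => //=; exact: qsol_time_gt0 hu.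
have [_ [[x t] [/= t0 tq] <-] ut] : exists2 y, S y & y < d * eps.
  by apply/inf_lt; rewrite // infS mulr_gt0.
exists x, t; split => //; last exact: ltW.
(* The cylinder contains time 0, which is excluded because the initial values exceed [d * eps]. *)
rewrite lt_neqAle t0 andbT; apply/eqP => E.
have : d * eps < u x t.
  by rewrite -E (qsol_init hu) mulrC ltr_pM2l// (lt_le_trans dg).
by rewrite ltNge (ltW ut).
Qed.

(* The range of f * g is compact, so its supremum is the maximum. *)
Theorem theorem1p2 (R : realType) (n : nat) (f g : R -> R)
    (u : R -> R -> R -> R)
    (hn : (1 <= n)%N)
    (f_torus : torus_fun f) (f_C1 : class_C 1 f) (f_gt0 : forall x, 0 < f x)
    (g_torus : torus_fun g) (g_C2 : class_C 2 g) (g_gt0 : forall x, 0 < g x)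
    (hu : forall eps : R, 0 < eps -> quenching_solution n f g eps (u eps))
    (hfg : sup (range (fun x => f x * g x)) < n%:R - 1) :
  eps_limit_quenching u.
Proof.
have derivable_cont (h : R -> R) : (forall x, derivable h x 1) -> continuous h.
  by move=> dh x; apply/differentiable_continuous/derivable1_diffP.
have fc : continuous f by apply: derivable_cont => x; exact: (f_C1.1 0%N).
have gc : continuous g by apply: derivable_cont => x; exact: (g_C2.1 0%N).
have g'c : continuous (derive1 g).
  by apply: derivable_cont => x; exact: (g_C2.1 1%N).
have g'T : torus_fun (derive1 g) by exact: torus_fun_derive1.
have [F fF] := torus_fun_bounded _ _ f_torus fc.
have [M1 gM1] := torus_fun_bounded _ _ g'T g'c.
have [M2 gM2] := torus_fun_bounded _ _ (torus_fun_derive1 _ _ g'T) g_C2.2.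
have [xM gxM] := torus_fun_max _ _ g_torus gc.
have [x0 gx0] : exists x0, forall x, g x0 <= g x.
  have [x|x|x0 H] := torus_fun_max _ (fun x => - g x).
  - by rewrite g_torus.
  - exact: cvgN (gc x).
  - by exists x0 => x; rewrite -lerN2.
have fgle x : f x * g x <= sup (range (fun x => f x * g x)).
  (* An explicit upper bound is needed for [sup] to be a genuine supremum. *)
  apply: ub_le_sup; last by exists x.
  exists (F * g xM) => _ [y _ <-].
  apply: ler_pM => //; [exact: ltW|exact: ltW|].
  exact: le_trans (ler_norm _) (fF y).
set s := sup _ in hfg fgle.
(* The product of [f] and [g] is nonnegative, so [hfg] rules out n = 1. *)
have n1 : 1 < n%:R :> R.
  rewrite -subr_gt0; apply: le_lt_trans hfg; apply: le_trans (fgle 0).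
  by rewrite mulr_ge0 ?ltW.
(* Chosen so that [2 * c * g] equals the available gap where [g] is largest. *)
pose c := (n%:R - 1 - s) / (2 * g xM).
have c0 : 0 < c by rewrite divr_gt0 ?subr_gt0 ?mulr_gt0.
have fgc x : f x * g x <= (n%:R - 1) - 2 * c * g x.
  apply: (le_trans (fgle x)).
  have : 2 * c * g x <= 2 * c * g xM.
    by rewrite ler_wpM2l// mulr_ge0// ltW.
  have -> : 2 * c * g xM = n%:R - 1 - s.
    by rewrite /c; field; rewrite lt0r_neq0.
  lra.
pose B := M2 + F * M1 ^+ 2.
have B0 : 0 <= B.
  rewrite addr_ge0 ?(le_trans _ (gM2 0))// mulr_ge0 ?sqr_ge0//.
  exact: le_trans (fF 0).
(* Both [eps] and the quotient are bounded by the harmonic sequence, so that squeezing gives the two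
   limits. *)
have step k : exists p : R * R * R, [/\ 0 < p.1.1 <= k.+1%:R^-1, 0 < p.2,
    (p.2%:E < quenching_time (u p.1.1))%E &
    0 <= u p.1.1 p.1.2 p.2 / p.1.1 <= k.+1%:R^-1].
  have k0 : 0 < k.+1%:R^-1 :> R by rewrite invr_gt0.
  have k1 : k.+1%:R^-1 <= 1 :> R by rewrite invf_le1// ler1n.
  (* As [eps <= 1], the second bound gives [eps ^+ 2 * B <= c]; the added 1 avoids a zero
     denominator. *)
  pose eps : R := Num.min k.+1%:R^-1 (c / (B + 1)).
  have B1 : 0 < B + 1 by lra.
  have e0 : 0 < eps by rewrite lt_min k0 divr_gt0.
  have ek : eps <= k.+1%:R^-1 by rewrite ge_min lexx.
  (* The first entry controls the quotient, the second keeps [d] below the minimum of [g]. *)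
  pose d := Num.min k.+1%:R^-1 (g x0 / 2).
  have gx02 : 0 < g x0 / 2 by rewrite divr_gt0.
  have d0 : 0 < d by rewrite lt_min k0.
  have dg : d < g x0 by rewrite gt_min; apply/orP; right; lra.
  have small : eps ^+ 2 * B <= c.
    have : eps * (B + 1) <= c by rewrite -ler_pdivlMr// ge_min lexx orbT.
    have : eps ^+ 2 * B <= eps * B.
      by rewrite ler_wpM2r// expr2 ler_piMr// ?(ltW e0)// (le_trans ek).
    lra.
  have fF' x : 0 < f x <= F by rewrite f_gt0 (le_trans (ler_norm _)).
  have [x [t [t0 tq ut]]] := quenching_solution_small _ _ _ _ _ _ c d F M1 M2 x0
    (hu _ e0) g_torus g_C2 n1 e0 c0 d0 fF' g_gt0 fgc gM1 gM2 small gx0 dg.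
  have u0 : 0 < u eps x t.
    by apply: (qsol_gt0 (hu _ e0)); split => //=; exact: ltW.
  exists (eps, x, t); split => //=; first by rewrite e0.
  rewrite divr_ge0 ?(ltW u0) ?(ltW e0)//= ler_pdivrMr//.
  by apply: (le_trans ut); rewrite ler_pM2r// ge_min lexx.
have [p pP] := choice step.
exists (fun k => (p k).1.1), (fun k => (p k).1.2), (fun k => (p k).2); split.
- by move=> k; have [/andP[]] := pP k.
- apply: (squeeze_cvgr _ (cvg_cst 0) (@cvg_harmonic R)).
  by near=> k; have [/andP[/ltW -> ->]] := pP k.
- by move=> k; have [] := pP k.
- apply: (squeeze_cvgr _ (cvg_cst 0) (@cvg_harmonic R)).
  by near=> k; have [] := pP k.
Unshelve. all: by end_near.
Qed.
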